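(* Let $G$ be a finite undirected graph (possibly with loops and multiple edges) with nonempty vertex set $V$ and edge set $E$, and let $b\in\mathbb{R}^V$ have all entries nonnegative. If $\mathcal{P}(G,b)$ contains a strictly positive element (i.e. an element $x$ with $x_e>0$ for each $e\in E$), then the dimension of $\mathcal{P}(G,b)$ is $|E|-|V|+B$, where $B$ is the number of bipartite components of $G$.
   Context: $\delta_G(v)$ denotes the set of edges of $G$ incident with $v$; a loop at $v$ appears once in $\delta_G(v)$. $\mathcal{P}(G,b)=\{x\in\mathbb{R}^E \mid x_e\ge 0 \text{ for each } e\in E,\ \sum_{e\in\delta_G(v)}x_e=b_v \text{ for each } v\in V\}$ (a polytope; when $E=\emptyset$, $\mathbb{R}^\emptyset=\{0\}$, so it is $\{0\}$ if $b=0$ and $\emptyset$ otherwise). A graph with loops is bipartite if and only if it has no odd-length cycle, where a vertex with a loop is a cycle of length 1 and two distinct parallel edges between two distinct vertices form a cycle of length 2; in particular an isolated vertex (with no loop) is a bipartite component. *)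

(* Defs.v *)
From mathcomp Require Import all_boot all_order all_algebra.
From mathcomp Require Import boolp classical_sets reals.

Set Implicit Arguments.
Unset Strict Implicit.
Unset Printing Implicit Defensive.
Import Order.TTheory GRing.Theory Num.Theory.
Local Open Scope classical_set_scope.
Local Open Scope ring_scope.

(* Edges are unordered: a loop has one end, any other edge has two.  Distinct
   elements of E may have the same ends, which allows multiple edges. *)
Record multigraph (V E : finType) := Multigraph {
  ends : E -> {set V};
  card_ends : forall e, (0 < #|ends e| <= 2)%N }.

Section Graph.
Variables (V E : finType) (G : multigraph V E).

Definition delta (v : V) : {set E} := [set e | v \in ends G e]%SET.

Definition adjacent : rel V :=
  [rel u v | [exists e, (u \in ends G e) && (v \in ends G e)]].

Definition components : {set {set V}} :=
  equivalence_partition (connect adjacent) [set: V]%SET.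

(* [zip vs (rot 1 vs)] pairs each vertex with its cyclic successor, so the
   i-th edge joins v_i to v_(i+1 mod k).  For k = 1 this is a loop at v_0, and
   for k = 2 a pair of distinct parallel edges. *)
Definition is_cycle (vs : seq V) (es : seq E) : Prop :=
  [/\ es != [::], uniq vs, uniq es &
      [seq ends G e | e <- es] =
      [seq [set p.1; p.2]%SET | p <- zip vs (rot 1 vs)]].

Definition bipartite_component (C : {set V}) : Prop :=
  C \in components /\
  forall vs es, is_cycle vs es -> {subset vs <= C} -> ~~ odd (size es).

Definition nb_bipartite_components : nat :=
  #|[set C | `[< bipartite_component C >]]%SET|.

End Graph.

(* The regular module R^o only serves to make {ffun E -> R^o}, i.e. the space
   of real vectors indexed by E, a vectType over R. *)
Definition polytope (R : realType) (V E : finType) (G : multigraph V E)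
    (b : {ffun V -> R}) : set {ffun E -> R^o} :=
  [set x : {ffun E -> R^o} |
    (forall e, 0 <= x e :> R) /\ forall v, \sum_(e in delta G v) x e = b v].

Section Dimension.
Variables (R : realType) (W : vectType R).

Definition affine_hull (P : set W) : set W :=
  [set y | exists n (p : 'I_n -> W) (c : 'I_n -> R),
    [/\ forall i, P (p i), \sum_(i < n) c i = 1 &
        y = \sum_(i < n) c i *: p i]].

(* The dimension of P is that of the linear direction U of its affine hull
   x + U, and -1 if P is empty. *)
Definition has_dimension (P : set W) (d : int) : Prop :=
  (P = set0 /\ d = -1) \/
  exists (x : W) (U : {vspace W}),
    affine_hull P = [set x + u | u in [set` U]] /\ d = (\dim U)%:Z.

Lemma has_dimension_unique (P : set W) (d d' : int) :
  has_dimension P d -> has_dimension P d' -> d = d'.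
Proof.
have hull0 x (U : {vspace W}) :
    affine_hull set0 = [set x + u | u in [set` U]] -> False.
  move=> eqH; have : affine_hull set0 x.
    by rewrite eqH; exists 0; rewrite ?addr0 //=; exact: mem0v.
  case=> [[|n]] [p [c [pP c1 _]]]; last exact: (pP ord0).
  by move: c1; rewrite big_ord0 => /esym/eqP; rewrite oner_eq0.
have sub x (U : {vspace W}) x' (U' : {vspace W}) :
    [set x + u | u in [set` U]] = [set x' + u | u in [set` U']] ->
    (U <= U')%VS.
  move=> eqUU'; apply/subvP => u uU.
  have mem w : w \in U -> exists2 w', w' \in U' & x' + w' = x + w.
    move=> wU; have : [set x + u | u in [set` U]] (x + w) by exists w.
    by rewrite eqUU' => -[w' ? ?]; exists w'.
  have [w1 w1U' e1] := mem _ uU.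
  have [w0 w0U' e0] := mem _ (mem0v U).
  suff -> : u = w1 - w0 by rewrite rpredB.
  by rewrite -[u](addKr x) -e1 -[x in - x + _]addr0 -e0 opprD addrACA addNr
             add0r addrC.
case=> [[P0 ->]|[x [U [eqU ->]]]].
  by case=> [[_ ->]//|[x [U [eqU _]]]]; case: (hull0 x U); rewrite -P0.
case=> [[P0 _]|[x' [U' [eqU' ->]]]]; first by case: (hull0 x U); rewrite -P0.
congr ((\dim _)%:Z); apply/eqP; rewrite eqEsubv.
by rewrite (sub x U x' U') ?(sub x' U' x U) // -eqU -eqU'.
Qed.

End Dimension.

(* Main.v *)
From HB Require Import structures.
Require Import Defs.
From mathcomp Require Import all_boot all_order all_algebra.
From mathcomp Require Import boolp classical_sets reals.
From mathcomp Require Import ring lra zify.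

Set Implicit Arguments.
Unset Strict Implicit.
Unset Printing Implicit Defensive.
Import Order.TTheory GRing.Theory Num.Theory.
Local Open Scope ring_scope.

(* The affine hull of the polytope is x + U, where U is the kernel of the
   incidence map x |-> (sum_(e incident to v) x e)_v: for u in U, the strictly
   positive x can be moved by a small multiple of u inside the polytope.  Hence
   the dimension is |E| - rank = |E| - |V| + dim K, where K is the space of the
   y : V -> R whose sum over the ends of every edge is 0.  Such a y changes sign
   along each edge, so it vanishes on every component with an odd closed walk,
   and on the others it is a multiple of the sign of a 2-colouring.  An odd
   closed walk of minimal length is an odd cycle, so the latter components are
   the bipartite ones. *)

(** * Cyclic sequences and odd cycles of a relation *)

Lemma path_rcons_zip (T : Type) (e : rel T) x s y :
  path e x (rcons s y) = all (fun p => e p.1 p.2) (zip (x :: s) (rcons s y)).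
Proof. by elim: s x => [|z s IHs] x //=; rewrite IHs. Qed.

Lemma cycle_zip (T : Type) (e : rel T) s :
  cycle e s = all (fun p => e p.1 p.2) (zip s (rot 1 s)).
Proof. by case: s => [|x s] //; rewrite rot1_cons /= path_rcons_zip. Qed.

Lemma zip_rot1_next (T : eqType) (s : seq T) p :
  uniq s -> p \in zip s (rot 1 s) -> p.1 \in s /\ p.2 = next s p.1.
Proof.
move=> Us; have szs : size s = size (rot 1 s) by rewrite size_rot.
case/(nthP p) => i; rewrite size1_zip ?szs // -szs => lt_i.
rewrite {1}[p]surjective_pairing nth_zip // => <- /=.
have ms : nth p.1 s i \in s by rewrite mem_nth.
split=> //; rewrite next_nth ms index_uniq //.
case: s lt_i {Us szs ms} => [|x s] //; rewrite rot1_cons nth_rcons /=.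
rewrite ltnS leq_eqVlt => /predU1P[->|lt_i].
  by rewrite ltnn eqxx nth_default.
by rewrite lt_i; apply: set_nth_default.
Qed.

(** A return after two steps along a duplicate-free cycle forces length 1 or 2, and oddness excludes
    2. *)
Lemma next_next_neq (T : eqType) (s : seq T) x :
  uniq s -> x \in s -> odd (size s) -> next s (next s x) = x -> next s x = x.
Proof.
move=> Us /rot_to[i s' def_s]; rewrite -(size_rot i) -!(next_rot i Us).
rewrite -(rot_uniq i) def_s in Us *.
case: s' Us {def_s} => [|y [|z s']] //=; rewrite ?eqxx //.
rewrite !inE !negb_or => /and3P[/and3P[xy xz _] _ _] _.
by rewrite eq_sym (negPf xy) => zx; rewrite zx eqxx in xz.
Qed.

(** A repeated vertex splits a closed walk into two shorter ones whose lengths add up to the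
    original length, so one of them is odd and the induction applies to it. *)
Lemma odd_cycle_uniq (T : eqType) (e : rel T) (s : seq T) :
  cycle e s -> odd (size s) ->
  exists s', [/\ cycle e s', uniq s', odd (size s') & {subset s' <= s}].
Proof.
have [n] := ubnP (size s); elim: n s => // n IHn s /ltnSE-le_s_n cs os.
have [Us | nUs] := boolP (uniq s); first by exists s; split.
(* The closed walk is rotated to start at the repeated vertex, hence a permutation of [s] and not
   [s] itself. *)
have [x [s1 [s2 def_s]]] :
    exists x s1 s2, perm_eq s (x :: s1 ++ x :: s2) /\
      cycle e (x :: s1 ++ x :: s2).
  suff [x [s1 [s2 [s3 def_s]]]] :
      exists x s1 s2 s3, s = s1 ++ x :: s2 ++ x :: s3.
    exists x, s2, (s3 ++ s1); split; last first.
      by move: cs; rewrite -(rot_cycle (size s1)) def_s rot_size_cat /= -catA.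
    by rewrite def_s perm_catC /= -catA.
  elim: {n IHn le_s_n cs os} s nUs => //= x s IHs.
  rewrite negb_and negbK => /orP[/splitPr[s2 s3]|/IHs].
    by exists x, [::], s2, s3.
  by case=> [y [s1 [s2 [s3 ->]]]]; exists y, (x :: s1), s2, s3.
case: def_s => def_s; rewrite /= rcons_cat cat_path /= => /and3P[p1 e1 p2].
have szs := perm_size def_s.
rewrite /= size_cat /= in szs.
have [o1 | o1] := boolP (odd (size (x :: s1))).
  have [||s' [? ? ? sub]] := IHn (x :: s1) _ _ o1.
  - by move: le_s_n; rewrite szs /= addnS; apply: leq_trans;
    rewrite !ltnS leq_addr.
  - by rewrite /= rcons_path p1.
  exists s'; split=> // z /sub zs; rewrite (perm_mem def_s) -cat_cons mem_cat.
  by rewrite zs.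
have [|||s' [? ? ? sub]] := IHn (x :: s2).
- by move: le_s_n; rewrite szs /= addnS; apply: leq_trans;
  rewrite !ltnS leq_addl.
- by [].
- by move: os o1; rewrite szs /= oddD /= negbK; case: (odd _) => //= /negPn.
exists s'; split=> // z /sub zs; rewrite (perm_mem def_s) -cat_cons mem_cat.
by rewrite zs orbT.
Qed.

(** * Odd closed walks, odd cycles and bipartite components *)

Section DoubleCover.
Variables (V E : finType) (G : multigraph V E).

(** Unlike [adjacent], which relates each end of any edge to itself, this is reflexive at [u] only
    if there is a loop at [u], so that parities of walks are meaningful. *)
Definition joined : rel V := [rel u v | [exists e, ends G e == [set u; v]%SET]].

(* The bipartite double cover: a walk from (u, a) to (v, c) is a walk from u
   to v whose length has parity a (+) c. *)
Definition double_cover : rel (V * bool) :=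
  [rel p q | joined p.1 q.1 && (q.2 == ~~ p.2)].

Lemma joined_sym : symmetric joined.
Proof. by move=> u v; apply: eq_existsb => e; rewrite finset.setUC. Qed.

Lemma ends_pair e : exists u v, ends G e = [set u; v]%SET.
Proof.
have := card_ends G e; case/andP=> /card_gt0P[u ue] le2.
have [/set0Pn[v] | ] := boolP (ends G e :\ u != finset.set0)%SET.
  rewrite !inE => /andP[vu ve]; exists u, v; apply/esym/eqP.
  by rewrite eqEcard cards2 eq_sym vu le2 andbT finset.subUset
    !finset.sub1set ue.
rewrite negbK finset.setD_eq0 => sub; exists u, u; apply/eqP.
by rewrite finset.setUid finset.eqEsubset sub finset.sub1set.
Qed.

Lemma joined_adjacent u v : joined u v -> adjacent G u v.
Proof.
case/existsP=> e /eqP he; apply/existsP; exists e.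
by rewrite he !inE !eqxx orbT.
Qed.

Lemma adjacent_joined u v : adjacent G u v -> u != v -> joined u v.
Proof.
case/existsP=> e /andP[]; have [x [y he]] := ends_pair e.
rewrite he !inE => hu hv nuv; apply/existsP; exists e; rewrite he.
by move: hu hv nuv => /orP[]/eqP-> /orP[]/eqP->; rewrite ?eqxx // finset.setUC.
Qed.

Lemma adjacent_sym : symmetric (adjacent G).
Proof. by move=> u v; apply: eq_existsb => e; rewrite andbC. Qed.

Lemma connect_adjacent_sym : connect_sym (adjacent G).
Proof. exact/sym_connect_sym/adjacent_sym. Qed.

Lemma connect_cover_sym : connect_sym double_cover.
Proof.
apply: sym_connect_sym => -[u a] [v c]; rewrite /double_cover /= joined_sym.
by case: a c => [] [].
Qed.

(** Negating the second coordinate is an automorphism of the double cover. *)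
Lemma connect_cover_flip u a v c :
  connect double_cover (u, a) (v, c) ->
  connect double_cover (u, ~~ a) (v, ~~ c).
Proof.
case/connectP=> p; elim: p u a => [|[w d] p IHp] u a /=.
  by move=> _ [-> ->].
case/andP=> /andP[/= uw /eqP->] /IHp IH /IH; apply: connect_trans.
by apply: connect1; rewrite /double_cover /= uw eqxx.
Qed.

Lemma connect_adjacent_cover u v :
  connect (adjacent G) u v -> exists c, connect double_cover (u, false) (v, c).
Proof.
case/connectP=> p; elim: p u => [|w p IHp] u /=.
  by move=> _ ->; exists false.
case/andP=> uw /IHp IH /IH[c wc].
(* An [adjacent] step from a vertex to itself need not come from a loop; it is dropped. *)
have [->|nuw] := eqVneq u w; first by exists c.
exists (~~ c); apply: connect_trans (connect_cover_flip wc).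
by apply: connect1; rewrite /double_cover /= adjacent_joined.
Qed.

Lemma cover_pathP u a p c : path joined u p -> c = a (+) odd (size p) ->
  connect double_cover (u, a) (last u p, c).
Proof.
move=> + ->; elim: p u a => [|w p IHp] u a /=; first by rewrite addbF.
case/andP=> uw /(IHp _ (~~ a)); rewrite addNb -addbN.
by apply: connect_trans; apply: connect1; rewrite /double_cover /= uw eqxx.
Qed.

Lemma path_cover u a p : path double_cover (u, a) p ->
  path joined u (unzip1 p) /\ (last (u, a) p).2 = a (+) odd (size p).
Proof.
elim: p u a => [|[w d] p IHp] u a /=; first by rewrite addbF.
by case/andP=> /andP[/= -> /eqP->] /IHp[-> ->]; rewrite addNb -addbN.
Qed.

Definition odd_closed_walk u := connect double_cover (u, false) (u, true).

(** Going from [v] to [u], around the odd closed walk, and back the same way uses the connecting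
    walk twice, so the total length stays odd. *)
Lemma odd_closed_walk_connect u v :
  connect (adjacent G) u v -> odd_closed_walk u -> odd_closed_walk v.
Proof.
case/connect_adjacent_cover=> c uc uu.
have vu: connect double_cover (v, c) (u, false) by rewrite connect_cover_sym.
have := connect_trans (connect_trans vu uu) (connect_cover_flip uc).
case: c {uc vu} => // vv.
by rewrite /odd_closed_walk connect_cover_sym.
Qed.

Lemma joined_edges (ps : seq (V * V)) :
  all (fun p => joined p.1 p.2) ps ->
  exists es, [seq ends G e | e <- es] = [seq [set p.1; p.2]%SET | p <- ps].
Proof.
elim: ps => [|p ps IHps] /=; first by exists [::].
case/andP=> /existsP[e /eqP he] /IHps[es hes]; exists (e :: es).
by rewrite /= he hes.
Qed.

(** If distinct [x] and [y] gave the same pair, each would be the successor of the other, which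
    happens only in length 2. Hence edges chosen along an odd cycle are automatically distinct. *)
Lemma odd_cycle_edges_uniq (vs : seq V) : uniq vs -> odd (size vs) ->
  uniq [seq [set p.1; p.2]%SET | p <- zip vs (rot 1 vs)].
Proof.
move=> Uvs ovs; rewrite map_inj_in_uniq.
  have : uniq (unzip1 (zip vs (rot 1 vs))) by rewrite unzip1_zip ?size_rot.
  exact: map_uniq.
move=> p q /(zip_rot1_next Uvs)[+ +] /(zip_rot1_next Uvs)[].
case: p q => [x x'] [y y'] /= yvs -> xvs -> /setP eq_xy.
have := eq_xy x; rewrite !inE eqxx /= => /esym/orP[/eqP-> // | /eqP xy].
have := eq_xy y; rewrite !inE eqxx /= => /orP[/eqP-> // | /eqP yx].
have nx : next vs x = x by apply: next_next_neq => //; rewrite -yx.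
by rewrite -yx -xy yx nx.
Qed.

Lemma odd_closed_walk_cycle u : odd_closed_walk u ->
  exists vs es, [/\ is_cycle G vs es, odd (size es) &
                    {in vs, forall v, connect (adjacent G) u v}].
Proof.
case/connectP=> p; case: (lastP p) => // {}p [w d] pp.
rewrite last_rcons => -[eq_w eq_d]; move: pp; rewrite -{w}eq_w -{d}eq_d.
case/path_cover; rewrite /unzip1 map_rcons size_rcons last_rcons /= => pp.
move/esym => op.
have conn_p v : v \in u :: unzip1 p -> connect (adjacent G) u v.
  move=> hv; apply: (path_connect (sub_path joined_adjacent pp)).
  by rewrite !inE mem_rcons hv orbT.
(* The projection to [V] is an odd closed walk; its final return to [u] is left out of the list. *)
have [] := @odd_cycle_uniq _ joined (u :: unzip1 p).
- exact: pp.
- by rewrite /= size_map.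
move=> vs [cvs Uvs ovs sub]; move: (cvs); rewrite cycle_zip.
case/joined_edges => es hes; exists vs, es.
have sz_es : size es = size vs.
  by rewrite -(size_map (ends G)) hes size_map size1_zip // size_rot.
rewrite sz_es; split=> // [|v /sub/conn_p //]; split=> //.
  by case: es sz_es {hes} => // sz0; rewrite -sz0 in ovs.
by apply: (@map_uniq _ _ (ends G)); rewrite hes odd_cycle_edges_uniq.
Qed.

Lemma cycle_odd_closed_walk vs es : is_cycle G vs es -> odd (size es) ->
  {in vs, forall u, odd_closed_walk u}.
Proof.
case=> _ _ _ hes; have szs : size vs = size es.
  by rewrite -[RHS](size_map (ends G)) hes size_map size1_zip // size_rot.
rewrite -szs => ovs u /rot_to[i s def_s].
have : cycle joined vs.
  rewrite cycle_zip; apply/allP => p pz; apply/existsP.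
  have : [set p.1; p.2]%SET \in [seq ends G e | e <- es].
    by rewrite hes; apply/mapP; exists p.
  by case/mapP=> e _ ->; exists e.
rewrite -(rot_cycle i) -(size_rot i) {}def_s in ovs * => /=.
move=> /cover_pathP-/(_ false true); rewrite last_rcons; apply.
by rewrite size_rcons addFb; apply: esym ovs.
Qed.

Lemma component_root C : C \in components G ->
  exists r, C = [set v | connect (adjacent G) r v]%SET.
Proof.
case/imsetP=> r _ ->; exists r; apply/setP=> v; rewrite !inE //.
Qed.

(** An odd closed walk at [r] contains an odd cycle inside the component; conversely, an odd cycle
    is an odd closed walk at each of its vertices, and this property is carried over to [r]. *)
Lemma bipartite_root r :
  bipartite_component G [set v | connect (adjacent G) r v]%SET <->
  ~~ odd_closed_walk r.
Proof.
split=> [[_ bipC] | nor].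
  apply/negP => /odd_closed_walk_cycle[vs [es [cyc oes conn]]].
  by move: oes; apply/negP/(bipC _ _ cyc) => v /conn; rewrite inE.
split.
  by apply/imsetP; exists r; rewrite ?inE //; apply/setP=> v; rewrite !inE.
move=> vs es cyc sub; apply: contra nor => oes.
have [v vvs] : exists v, v \in vs.
  case: cyc => es0 _ _ hes; case: vs hes {sub} => [|v vs] hes; last first.
    by exists v; rewrite mem_head.
  by case: es es0 hes {oes}.
apply: (@odd_closed_walk_connect v); last first.
  exact: cycle_odd_closed_walk cyc oes v vvs.
by rewrite connect_adjacent_sym; have := sub v vvs; rewrite inE.
Qed.

End DoubleCover.

(** * Passage between functions on a finite type and row vectors *)

Lemma sum_enum_val_in (R : pzSemiRingType) (T : finType) (A : {pred T})
    (F : T -> R) :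
  \sum_(i < #|T|) F (enum_val i) * (enum_val i \in A)%:R = \sum_(t in A) F t.
Proof.
rewrite [RHS]big_mkcond [RHS](reindex _ (onW_bij _ (@enum_val_bij T))) /=.
by apply: eq_bigr => i _; case: ifP => _; rewrite ?mulr1 ?mulr0.
Qed.

Definition row_of (R : Type) (T : finType) (x : T -> R) : 'rV[R]_#|T| :=
  \row_i x (enum_val i).

Section RowFun.
Variables (R : fieldType) (T : finType) (m : nat) (K : 'M[R]_(m, #|T|)).

Definition row_fun (t : 'rV[R]_(\rank K)) : {ffun T -> R^o} :=
  [ffun e => (t *m row_base K) 0 (enum_rank e)].

Fact row_fun_linear : linear row_fun.
Proof.
by move=> a s t; apply/ffunP=> e; rewrite !ffunE mulmxDl -scalemxAl !mxE.
Qed.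
HB.instance Definition _ :=
  GRing.isLinear.Build R 'rV[R]_(\rank K) {ffun T -> R^o} _ row_fun
    row_fun_linear.

(** This turns matrix ranks into dimensions of subspaces of functions: [row_fun] is injective
    because the rows of [row_base K] are independent. *)
Lemma row_space_vspace : exists U : {vspace {ffun T -> R^o}},
  \dim U = \rank K /\
  forall x, (x \in U) = (row_of (x : T -> R) <= K)%MS.
Proof.
have rowK t : row_of (row_fun t : T -> R) = t *m row_base K.
  by apply/rowP=> i; rewrite mxE ffunE enum_valK.
exists (limg (linfun row_fun)); split=> [|x].
  rewrite limg_dim_eq ?dimvf /dim /= ?mul1n //; apply/eqP.
  rewrite capfv; apply/lker0P => s t; rewrite !lfunE /= => eq_st.
  apply: (row_free_inj (row_base_free K)).
  by rewrite -!rowK eq_st.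
transitivity (row_of (x : T -> R) <= row_base K)%MS; last first.
  by rewrite eq_row_base.
apply/memv_imgP/submxP => [[t _ ->]|[t ht]].
  by exists t; rewrite lfunE -rowK.
exists t; rewrite ?memvf // lfunE; apply/ffunP=> e.
by rewrite ffunE -ht mxE enum_rankK.
Qed.

End RowFun.

(** * Kernel and cokernel of the incidence matrix *)

Section Incidence.
Variables (R : realFieldType) (V E : finType) (G : multigraph V E).

Definition edge_balanced (y : V -> R) :=
  forall e, \sum_(v in ends G e) y v = 0.

Lemma sum_pair (y : V -> R) u v :
  \sum_(w in [set u; v]%SET) y w = if u == v then y u else y u + y v.
Proof.
case: eqVneq => [->|nuv]; first by rewrite finset.setUid big_set1.
by rewrite big_setU1 ?inE // big_set1.
Qed.

(** Along a non-loop edge both [y] and the sign change; a loop contributes its end only once to the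
    sum, so [y] vanishes there. *)
Lemma edge_balanced_cover y u a v c : edge_balanced y ->
  connect (double_cover G) (u, a) (v, c) -> (-1) ^+ c * y v = (-1) ^+ a * y u.
Proof.
move=> by0 /connectP[p]; elim: p u a => [|[w d] p IHp] u a /=.
  by move=> _ [-> ->].
case/andP=> /andP[/existsP[e /eqP he] /eqP/= ->] /IHp IH /IH ->.
have := by0 e; rewrite he sum_pair signrN mulNr.
case: eqVneq => /= [-> ->|_ /eqP]; first by rewrite !mulr0 oppr0.
by rewrite addrC addr_eq0 => /eqP->; rewrite mulrN opprK.
Qed.

Lemma edge_balanced_odd y v : edge_balanced y -> odd_closed_walk G v -> y v = 0.
Proof. by move=> by0 /(edge_balanced_cover by0) /=; lra. Qed.

(* In a non-bipartite component, where v is reached from r by walks of both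
   parities, this is the junk value -1. *)
Definition colouring r v : R :=
  (-1) ^+ connect (double_cover G) (r, false) (v, true)
    *+ connect (adjacent G) r v.

Lemma colouring_outside r v : ~~ connect (adjacent G) r v -> colouring r v = 0.
Proof. by rewrite /colouring => /negPf->. Qed.

Lemma edge_balanced_colouring y r v : edge_balanced y ->
  connect (adjacent G) r v -> ~~ odd_closed_walk G r ->
  y v = y r * colouring r v.
Proof.
move=> by0 rv nor; rewrite /colouring rv mulr1n.
(* The sign used by [colouring] is the parity of an actual walk: if no odd walk reaches [v], an even
   one does. *)
suff rvc : connect (double_cover G) (r, false)
    (v, connect (double_cover G) (r, false) (v, true)).
  have := edge_balanced_cover by0 rvc; rewrite mul1r => <-.
  by rewrite mulrAC -expr2 sqrr_sign mul1r.
case rvt: (connect _ _ (v, true)) => //.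
by have [[] rvc] := connect_adjacent_cover rv; first by rewrite rvc in rvt.
Qed.

Lemma colouring_edge_balanced r :
  ~~ odd_closed_walk G r -> edge_balanced (colouring r).
Proof.
move=> nor e; have [u [v he]] := ends_pair G e.
have uv : joined G u v by apply/existsP; exists e; rewrite he.
have step a : connect (double_cover G) (u, a) (v, ~~ a).
  by apply: connect1; rewrite /double_cover /= uv eqxx.
have eq_conn : connect (adjacent G) r v = connect (adjacent G) r u.
  apply: (same_connect_r (connect_adjacent_sym G)); apply: connect1.
  by rewrite adjacent_sym joined_adjacent.
rewrite he sum_pair /colouring eq_conn.
have [ru|_] := boolP (connect _ r u); last by rewrite !mulr0n addr0 if_same.
have nou : ~~ odd_closed_walk G u.
  by apply: contra nor; apply: odd_closed_walk_connect;
    rewrite connect_adjacent_sym.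
(* A loop would be an odd closed walk of length 1. *)
case: eqVneq => [eq_uv|_].
  by case/negP: nou; have := step false; rewrite -eq_uv.
(* Walks from [r] to [u] all have the same parity, and the edge turns it into the opposite parity at
   [v]. *)
suff -> : connect (double_cover G) (r, false) (v, true) =
    ~~ connect (double_cover G) (r, false) (u, true).
  by rewrite signrN !mulr1n subrr.
have not_both : ~~ (connect (double_cover G) (r, false) (u, true) &&
    connect (double_cover G) (r, false) (u, false)).
  apply: contra nou => /andP[rt rf]; rewrite connect_cover_sym in rf.
  exact: connect_trans rf rt.
have -> : connect (double_cover G) (r, false) (v, true) =
    connect (double_cover G) (r, false) (u, false).
  apply: (same_connect_r (connect_cover_sym G)).
  by rewrite connect_cover_sym; apply: step.
have [[] rc] := connect_adjacent_cover ru; move: not_both; rewrite rc /=.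
  by move/negPf.
by rewrite andbT => /negPf->.
Qed.

Lemma bipartite_roots :
  exists r : 'I_(nb_bipartite_components G) -> V,
    [/\ forall i, ~~ odd_closed_walk G (r i),
        forall i j, connect (adjacent G) (r i) (r j) -> i = j &
        forall v, ~~ odd_closed_walk G v ->
          exists i, connect (adjacent G) (r i) v].
Proof.
pose B := [set C | `[< bipartite_component G C >]]%SET.
have /fin_all_exists[r hr] (i : 'I_#|B|) :
    exists r, enum_val i = [set v | connect (adjacent G) r v]%SET.
  by have := enum_valP i; rewrite inE => /asboolP[/component_root].
exists r; split=> [i|i j rij|v nov].
- by apply/bipartite_root; have := enum_valP i; rewrite inE hr => /asboolP.
- apply: enum_val_inj; rewrite !hr; apply/setP=> v; rewrite !inE.
  exact: (same_connect (connect_adjacent_sym G)).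
have vB : [set w | connect (adjacent G) v w]%SET \in B.
  by rewrite inE; apply/asboolP/bipartite_root.
exists (enum_rank_in vB [set w | connect (adjacent G) v w]%SET).
have := hr (enum_rank_in vB [set w | connect (adjacent G) v w]%SET).
rewrite enum_rankK_in // => /setP/(_ v); rewrite !inE connect0.
by move/esym.
Qed.

Definition incidence : 'M[R]_(#|E|, #|V|) :=
  \matrix_(i, j) (enum_val j \in ends G (enum_val i))%:R.

(** The colourings of the bipartite components, which are the rows of [N], form a basis of this
    kernel. The matrix [D] evaluates at the roots: [N *m D = 1%:M] gives independence, and
    [y = y *m D *m N] gives spanning. *)
Lemma rank_cokernel_incidence :
  \rank (kermx incidence^T) = nb_bipartite_components G.
Proof.
have [r [nor r_inj r_cover]] := bipartite_roots.
pose N : 'M[R]_(_, #|V|) := \matrix_(i, j) colouring (r i) (enum_val j).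
pose D : 'M[R]_(#|V|, _) := \matrix_(j, i) (enum_val j \in [set r i]%SET)%:R.
have mulD (F : V -> R) i :
    \sum_(j < #|V|) F (enum_val j) * (enum_val j \in [set r i]%SET)%:R =
      F (r i).
  by rewrite (sum_enum_val_in _ F) big_set1.
have col_root i k : colouring (r i) (r k) = (i == k)%:R.
  case: eqVneq => [<-|nik].
    by rewrite /colouring connect0 -/(odd_closed_walk G _) (negPf (nor i)).
  by apply: colouring_outside; apply: contra nik => /r_inj->.
have ND : N *m D = 1%:M.
  apply/matrixP=> i k; rewrite !mxE -[RHS]col_root -mulD.
  by apply: eq_bigr => j _; rewrite !mxE.
have rankN : \rank N = nb_bipartite_components G.
  by apply/eqP/row_freeP; exists D.
rewrite -rankN; apply/eqmx_rank/andP; split; last first.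
  apply/sub_kermxP/matrixP=> i e; rewrite !mxE.
  rewrite -[RHS](colouring_edge_balanced (nor i) (enum_val e)).
  by rewrite -[RHS]sum_enum_val_in; apply: eq_bigr => j _; rewrite !mxE.
apply/rV_subP => y /sub_kermxP/matrixP hy.
suff -> : y = y *m D *m N by apply: submxMl.
pose F v := y 0 (enum_rank v).
have F0 : edge_balanced F.
  move=> e; have := hy 0 (enum_rank e); rewrite !mxE => h.
  rewrite -[LHS]sum_enum_val_in -[RHS]h; apply: eq_bigr => j _.
  by rewrite !mxE /F enum_valK enum_rankK.
apply/rowP=> j; rewrite mxE.
have yD i : (y *m D) 0 i = F (r i).
  by rewrite mxE -mulD; apply: eq_bigr => k _; rewrite mxE /F enum_valK.
under eq_bigr do rewrite yD mxE.
rewrite -[j in LHS]enum_valK -/(F _).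
(* At a vertex with an odd closed walk both sides vanish; elsewhere only the root of the component
   of [v] contributes. *)
move: (enum_val j) => v; have [ov|nov] := boolP (odd_closed_walk G v).
  rewrite edge_balanced_odd // big1 // => i _.
  rewrite colouring_outside ?mulr0 //; apply: contra (nor i) => riv.
  by apply: odd_closed_walk_connect ov; rewrite connect_adjacent_sym.
have [i riv] := r_cover v nov.
rewrite (bigD1 i) //= -edge_balanced_colouring // big1 ?addr0 // => k nki.
rewrite colouring_outside ?mulr0 //; apply: contra nki => rkv.
apply/eqP/r_inj; apply: connect_trans rkv _.
by rewrite connect_adjacent_sym.
Qed.

(** Rank-nullity is applied to the incidence matrix and to its transpose, which have equal rank. *)
Lemma kernel_incidence_dim : exists U : {vspace {ffun E -> R^o}},
  (forall x, x \in U <-> forall v, \sum_(e in delta G v) x e = 0) /\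
  (\dim U)%:Z = #|E|%:Z - #|V|%:Z + (nb_bipartite_components G)%:Z.
Proof.
have [U [dimU memU]] := row_space_vspace (kermx incidence).
exists U; split=> [x|]; last first.
  rewrite dimU -rank_cokernel_incidence !mxrank_ker mxrank_tr.
  by rewrite -!subzn ?rank_leq_row ?rank_leq_col //; lia.
have sumE v : (row_of (x : E -> R) *m incidence) 0 (enum_rank v) =
    \sum_(e in delta G v) x e.
  rewrite mxE -[RHS]sum_enum_val_in; apply: eq_bigr => i _.
  by rewrite !mxE enum_rankK inE.
rewrite memU; split=> [/sub_kermxP x0 v|x0].
  by rewrite -sumE x0 mxE.
by apply/sub_kermxP/rowP=> j; rewrite -[j]enum_valK sumE x0 mxE.
Qed.

End Incidence.

(** * The affine hull and the dimension of the polytope *)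

Theorem corollary19 (R : realType) (V E : finType) (G : multigraph V E)
    (b : {ffun V -> R})
    (hV : (0 < #|V|)%N)
    (hb : forall v : V, 0 <= b v)
    (hpos : exists x : {ffun E -> R^o},
      polytope G b x /\ forall e : E, 0 < x e :> R) :
  has_dimension (polytope G b)
    (#|E|%:Z - #|V|%:Z + (nb_bipartite_components G)%:Z).
Proof.
have [x [[x_ge0 x_b] x_gt0]] := hpos.
have [U [memU dimU]] := kernel_incidence_dim R G.
right; exists x, U; split=> //; apply/seteqP; split=> y /=.
  (* An affine combination of points with vertex sums [b] again has vertex sums [b], so it differs
     from [x] by a kernel element. *)
  case=> n [p [c [pP c1 ->]]]; exists (\sum_(i < n) c i *: p i - x); last first.
    by rewrite addrC subrK.
  apply/memU => v; under eq_bigr do rewrite !ffunE sum_ffunE.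
  rewrite big_split /= sumrN x_b exchange_big /=.
  under eq_bigr => i _.
    under eq_bigr do rewrite ffunE.
    rewrite -scaler_sumr (pP i).2; over.
  by rewrite -scaler_suml c1 scale1r subrr.
case=> u /memU u0 <-.
(* The sum dominates every ratio, which keeps [x + t^-1 *: u] nonnegative; the 1 keeps [t] positive
   even for [u = 0]. *)
pose t : R := 1 + \sum_e `|u e| / x e.
have term_ge0 e : 0 <= `|u e| / x e by rewrite divr_ge0.
have t_gt0 : 0 < t by rewrite ltr_pwDl // sumr_ge0.
have u_le e : `|u e| <= t * x e.
  rewrite -ler_pdivrMr // /t (bigD1 e) //= addrCA lerDl addr_ge0 // sumr_ge0 //.
(* These realise [x + u = (1 - t) *: x + t *: (x + t^-1 *: u)]; the coefficient [1 - t] may be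
   negative. *)
pose p (i : 'I_2) : {ffun E -> R^o} := if i == ord0 then x else x + t^-1 *: u.
pose c (i : 'I_2) : R := if i == ord0 then 1 - t else t.
exists 2%N, p, c; split.
- move=> i; rewrite /p; case: ifP => _; split=> // [e|v].
    rewrite !ffunE -(pmulr_rge0 _ t_gt0) mulrDr mulVKf ?gt_eqF //.
    by have := u_le e; rewrite ler_norml; lra.
  under eq_bigr do rewrite !ffunE.
  by rewrite big_split /= -scaler_sumr u0 x_b scaler0 addr0.
- by rewrite !big_ord_recl big_ord0 /c /=; ring.
rewrite !big_ord_recl big_ord0 /c /p /= addr0 scalerDr scalerA divff ?gt_eqF //.
by rewrite scale1r addrA -scalerDl subrK scale1r.
Qed.
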